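(* Let $m\ge 2$ be an integer and let $K$ be a compact Hausdorff space such that $K^{(m)}\neq\emptyset$. Then $$d_{\rm BM}\big(C(K),C[0,\omega]\big)\ \ge\ m+\sqrt{(m-1)(m+3)} .$$
   Context: All compact spaces are Hausdorff. $C(K)$ is the Banach space of real-valued continuous functions on $K$ with the supremum norm. $[0,\omega]$ is the ordinal interval $\omega+1$ with the order topology, i.e. a convergent sequence together with its limit; $C[0,\omega]$ denotes $C([0,\omega])$. $K^{(n)}$ denotes the $n$-th Cantor–Bendixson derivative: $K^{(0)}=K$ and $K^{(n+1)}$ is the set of non-isolated points of $K^{(n)}$. For Banach spaces $X,Y$, an isomorphism is a bounded linear bijection (with bounded inverse), and $d_{\rm BM}(X,Y)=\inf\{\|T\|\cdot\|T^{-1}\| : T:X\to Y \text{ an isomorphism}\}$, with $d_{\rm BM}(X,Y)=\infty$ if $X$ and $Y$ are not isomorphic. *)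

(* Defs.v *)
From HB Require Import structures.
From mathcomp Require Import all_boot all_order all_algebra.
From mathcomp Require Import all_classical all_reals all_analysis.

Set Implicit Arguments.
Unset Strict Implicit.
Unset Printing Implicit Defensive.

Import Order.TTheory GRing.Theory Num.Theory.
Import numFieldNormedType.Exports.

Local Open Scope classical_set_scope.
Local Open Scope ring_scope.

Section CantorBendixson.
Context {K : topologicalType}.

Definition cb_derivative (n : nat) : set K :=
  iter n (fun A => A `\` isolated A) [set: K].

End CantorBendixson.

Arguments cb_derivative : clear implicits.

(* The compactness proof is a (phantom) parameter of the type because the sup
   norm is only a norm on the whole of continuousType K R when K is compact.  *)
Definition Cspace (R : realType) (K : topologicalType)
  (cK : compact [set: K]) : Type := continuousType K R.

Section Cspace_normedModType.
Context {R : realType} {K : topologicalType} {cK : compact [set: K]}.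
Local Notation CK := (Cspace R cK).
Implicit Types f g h : CK.

HB.instance Definition _ := Choice.copy CK (continuousType K R).

Definition Cspace_fun (f : CK) : K -> R := (f : continuousType K R).

Coercion Cspace_fun : Cspace >-> Funclass.

Lemma Cspace_continuous f : continuous f.
Proof. exact: (@cts_fun K R f). Qed.

Definition Cspace_of (f : K -> R) (cf : continuous f) : CK :=
  (mkcts cf : continuousType K R).

Lemma Cspace_ofE (f : K -> R) (cf : continuous f) x :
  Cspace_of cf x = f x.
Proof. by []. Qed.

Lemma CspaceP f g : f =1 g -> f = g.
Proof. by move=> fg; apply/(@continuousEP K R). Qed.

Let zero_cts : continuous (fun _ : K => 0 : R).
Proof. by move=> x; exact: cvg_cst. Qed.

Let opp_cts f : continuous (fun x => - f x).
Proof. by move=> x; apply: cvgN; exact: Cspace_continuous. Qed.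

Let add_cts f g : continuous (fun x => f x + g x).
Proof. by move=> x; apply: cvgD; exact: Cspace_continuous. Qed.

Let scale_cts (a : R) f : continuous (fun x => a * f x).
Proof.
by move=> x; apply: cvgM; [exact: cvg_cst|exact: Cspace_continuous].
Qed.

Definition Cspace_zero : CK := Cspace_of zero_cts.
Definition Cspace_opp f : CK := Cspace_of (@opp_cts f).
Definition Cspace_add f g : CK := Cspace_of (@add_cts f g).
Definition Cspace_scale (a : R) f : CK := Cspace_of (@scale_cts a f).

Let addA : associative Cspace_add.
Proof. by move=> f g h; apply: CspaceP => x; exact: addrA. Qed.

Let addC : commutative Cspace_add.
Proof. by move=> f g; apply: CspaceP => x; exact: addrC. Qed.

Let add0 : left_id Cspace_zero Cspace_add.
Proof. by move=> f; apply: CspaceP => x; exact: add0r. Qed.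

Let addN : left_inverse Cspace_zero Cspace_opp Cspace_add.
Proof. by move=> f; apply: CspaceP => x; exact: addNr. Qed.

HB.instance Definition _ := GRing.isZmodule.Build CK addA addC add0 addN.

Let scaleA (a b : R) f :
  Cspace_scale a (Cspace_scale b f) = Cspace_scale (a * b) f.
Proof. by apply: CspaceP => x; exact: mulrA. Qed.

Let scale1 : left_id 1 Cspace_scale.
Proof. by move=> f; apply: CspaceP => x; exact: mul1r. Qed.

Let scaleDr : right_distributive Cspace_scale +%R.
Proof. by move=> a f g; apply: CspaceP => x; exact: mulrDr. Qed.

Let scaleDl f : {morph Cspace_scale^~ f : a b / a + b}.
Proof. by move=> a b; apply: CspaceP => x; exact: mulrDl. Qed.

HB.instance Definition _ :=
  GRing.Zmodule_isLmodule.Build R CK scaleA scale1 scaleDr scaleDl.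

Lemma CspaceDE f g x : (f + g : CK) x = f x + g x.
Proof. by []. Qed.

Lemma CspaceNE f x : (- f : CK) x = - f x.
Proof. by []. Qed.

Lemma CspaceZE (a : R) f x : (a *: f : CK) x = a * f x.
Proof. by []. Qed.

Lemma Cspace0E x : (0 : CK) x = 0.
Proof. by []. Qed.

Definition sup_norm f : R := sup [set `|f x| | x in [set: K]].

Let norm_has_ubound f : has_ubound [set `|f x| | x in [set: K]].
Proof.
have /compact_bounded [M [_ HM]] :
    compact [set f x | x in [set: K]].
  apply: continuous_compact => //.
  exact/continuous_subspaceT/Cspace_continuous.
exists (M + 1) => _ [x _ <-].
by apply: (HM (M + 1)) => /=; [rewrite ltrDl|exists x].
Qed.

Lemma le_sup_norm f x : `|f x| <= sup_norm f.
Proof. by apply: ub_le_sup; [exact: norm_has_ubound|exists x]. Qed.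

Lemma sup_norm_ge0 f : 0 <= sup_norm f.
Proof.
have [[x _]|K0] := pselect ([set: K] !=set0).
  by rewrite (le_trans _ (le_sup_norm f x)).
rewrite /sup_norm [X in sup X](_ : _ = set0) ?sup0//.
by apply/seteqP; split=> // z [x _ _]; case: K0; exists x.
Qed.

Lemma sup_norm_le f (M : R) :
  0 <= M -> (forall x, `|f x| <= M) -> sup_norm f <= M.
Proof.
move=> M0 fM; have [[x _]|K0] := pselect ([set: K] !=set0).
  by apply: ge_sup => [|_ [y _ <-]//]; exists `|f x|, x.
rewrite /sup_norm [X in sup X](_ : _ = set0) ?sup0//.
by apply/seteqP; split=> // z [x _ _]; case: K0; exists x.
Qed.

Let normD f g : sup_norm (f + g) <= sup_norm f + sup_norm g.
Proof.
apply: sup_norm_le => [|x]; first by rewrite addr_ge0 ?sup_norm_ge0.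
by rewrite CspaceDE (le_trans (ler_normD _ _))// lerD ?le_sup_norm.
Qed.

Let normZ (a : R) f : sup_norm (a *: f) = `|a| * sup_norm f.
Proof.
have le_normZ b h : sup_norm (b *: h) <= `|b| * sup_norm h.
  apply: sup_norm_le => [|x]; first by rewrite mulr_ge0 ?sup_norm_ge0.
  by rewrite CspaceZE normrM ler_wpM2l ?le_sup_norm.
apply/eqP; rewrite eq_le le_normZ/=.
have [->|a0] := eqVneq a 0; first by rewrite normr0 mul0r sup_norm_ge0.
rewrite -{1}(scale1r f) -(mulVf a0) -scalerA.
by rewrite -ler_pdivlMl ?normr_gt0// -normfV le_normZ.
Qed.

Let norm0_eq0 f : sup_norm f = 0 -> f = 0.
Proof.
move=> f0; apply: CspaceP => x.
by apply/eqP; rewrite Cspace0E -normr_le0 -f0 le_sup_norm.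
Qed.

HB.instance Definition _ := Lmodule_isNormed.Build R CK normD normZ norm0_eq0.

Lemma Cspace_normE f :
  `|f| = sup [set `|f x| | x in [set: K]].
Proof. by []. Qed.

Lemma Cspace_complete (F : set_system CK) :
  ProperFilter F -> cauchy F -> cvg F.
Proof.
move=> FF /cauchyP Fc.
have evc x : cvg ((fun f : CK => f x) @ F).
  apply/cauchy_cvgP/cauchyP => e e0; have [f Ff] := Fc e e0.
  exists (f x); move: Ff; rewrite -!ball_normE/=; apply: filterS.
  by move=> g /=; apply: le_lt_trans; exact: (le_sup_norm (f - g)).
pose l x : R := lim ((fun f : CK => f x) @ F).
have Fl e : 0 < e ->
    \forall f \near F, forall x : K, `|l x - (f : CK) x| <= e.
  move=> e0; have [f0 Ff0] := Fc (e / 2) (divr_gt0 e0 (ltr0n _ 2)).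
  rewrite -ball_normE in Ff0; near=> f => x; rewrite distrC.
  apply: (@closed_cvg _ _ F FF (fun g : CK => g x)
    [set y | `|f x - y| <= e]) (evc x).
    have -> : [set y : R | `|f x - y| <= e] =
              (fun y => `|f x - y|) @^-1` [set z | z <= e] by [].
    apply: preimage_closed (@closed_le _ e) => y _.
    apply: cvg_norm; apply: cvgB; [exact: cvg_cst|exact: cvg_id].
  near=> g => /=.
  have fe : `|f0 - f| < e / 2.
    by near: f.
  have ge : `|f0 - g| < e / 2.
    by near: g.
  rewrite -(subrK (f0 x) (f x)) -addrA.
  rewrite (le_trans (ler_normD _ _))// [e]splitr lerD//.
    by rewrite distrC (le_trans _ (ltW fe))//; exact: (le_sup_norm (f0 - f)).
  by rewrite (le_trans _ (ltW ge))//; exact: (le_sup_norm (f0 - g)).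
have cl : continuous l.
  move=> x; apply/cvgrPdist_le => e e0.
  have e30 : 0 < e / 3 by rewrite divr_gt0.
  have [f fl] := filter_ex (Fl _ e30).
  have /cvgrPdist_le/(_ _ e30) := @Cspace_continuous f x.
  apply: filterS => y fxy.
  have -> : l x - l y = (l x - f x) +
      (f x - f y) + (f y - l y).
    by rewrite !addrA !subrK.
  have -> : e = e / 3 + e / 3 + e / 3.
    by rewrite -!mulrDl -mulr2n -mulrSr -[e *+ 3]mulr_natr mulfK.
  rewrite (le_trans (ler_normD _ _))// lerD//; last by rewrite distrC.
  by rewrite (le_trans (ler_normD _ _))// lerD.
apply/cvg_ex; exists (Cspace_of cl); apply/cvgrPdist_le => e e0.
apply: filterS (Fl _ e0) => f fl.
by apply: sup_norm_le => [|x]; [exact: ltW|exact: fl].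
Unshelve. all: by end_near. Qed.

HB.instance Definition _ := Uniform_isComplete.Build CK Cspace_complete.

End Cspace_normedModType.

(* The order type of omega + 1: Some n is the finite ordinal n, None is omega. *)
Definition omega_plus_one : Type := option nat.

Section omega_plus_one_order.

HB.instance Definition _ := Choice.copy omega_plus_one (option nat).

Definition le_omega (x y : omega_plus_one) : bool :=
  match x, y with
  | _, None => true
  | None, Some _ => false
  | Some m, Some n => (m <= n)%N
  end.

Let le_omega_refl : reflexive le_omega.
Proof. by case=> //= n. Qed.

Let le_omega_anti : antisymmetric le_omega.
Proof. by case=> [m|] [n|] //= /anti_leq ->. Qed.

Let le_omega_trans : transitive le_omega.
Proof. by case=> [n|] [m|] [p|] //=; exact: leq_trans. Qed.

Let le_omega_total : total le_omega.
Proof. by case=> [m|] [n|] //=; exact: leq_total. Qed.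

Fact omega_display : Order.disp_t. Proof. exact: (Order.Disp tt tt). Qed.

HB.instance Definition _ := Order.Le_isPOrder.Build omega_display
  omega_plus_one le_omega_refl le_omega_anti le_omega_trans.
HB.instance Definition _ :=
  Order.POrder_isTotal.Build omega_display omega_plus_one le_omega_total.

End omega_plus_one_order.

Definition interval_0_omega : topologicalType :=
  order_topology omega_plus_one.

Lemma compact_interval_0_omega : compact [set: interval_0_omega].
Proof.
have id_cts : continuous
    (id : one_point_compactification nat -> interval_0_omega).
  case=> [n|] U UU.
    have Un : U (Some n) := nbhs_singleton UU.
    change (nbhs n [set k | U (Some k)]); rewrite nbhs_principalE.
    exact/principal_filterP.
  have := UU; rewrite itv_nbhsE => -[[l r]] [oi /= li iU].
  have [N HN] : exists N, forall n, (N <= n)%N -> U (Some n).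
    suff [N HN] : exists N, forall n, (N <= n)%N ->
        (Some n : omega_plus_one) \in Interval l r.
      by exists N => n /HN /iU.
    move: oi li {iU}; case: l => [[] x|[]]; case: r => [[] y|[]] //=.
    - by move=> _ /andP[_]; rewrite bnd_simp ltNge; case: y.
    - move=> _ /andP[+ _]; rewrite bnd_simp ltNge; case: x => // k _.
      by exists k.+1 => n kn; apply/andP; split=> //;
        rewrite bnd_simp ltNge /Order.le/= -ltnNge.
    - by move=> _ /andP[_]; rewrite bnd_simp ltNge; case: y.
    - by exists 0%N.
  exists `I_N.
    by split; [exact: finite_compact|exact: discrete_closed].
  move=> _ [[n /= nN <-]|->]; last exact: nbhs_singleton UU.
  by apply: HN; rewrite leqNgt; apply/negP.
have -> : [set: interval_0_omega] = id @` [set: one_point_compactification nat].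
  by rewrite image_id.
apply: continuous_compact; first exact: continuous_subspaceT.
exact: one_point_compactification_compact.
Qed.

Section BanachMazur.
Context {R : realType}.

(* Meaningful for bounded T only: sup is 0 on sets that are not bounded above. *)
Definition op_norm (X Y : normedModType R) (T : X -> Y) : R :=
  sup [set `|T x| | x in [set x : X | `|x| <= 1]].

(* An isomorphism is given together with its inverse S; if there is none, the
   infimum is that of the empty set, i.e. +oo.                               *)
Definition dBM (X Y : normedModType R) : \bar R :=
  ereal_inf [set d | exists (T : {linear X -> Y}) (S : {linear Y -> X}),
    [/\ bounded_fun_norm T, bounded_fun_norm S, cancel T S, cancel S T &
        d = (op_norm T * op_norm S)%:E]].

End BanachMazur.

(* Main.v *)
Require Import Defs.
From HB Require Import structures.
From mathcomp Require Import all_boot all_order all_algebra.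
From mathcomp Require Import all_classical all_reals all_analysis.
From mathcomp Require Import ring lra.

Set Implicit Arguments.
Unset Strict Implicit.
Unset Printing Implicit Defensive.

Import Order.TTheory GRing.Theory Num.Theory.
Import numFieldNormedType.Exports.

Local Open Scope classical_set_scope.
Local Open Scope ring_scope.

(** A measure-theoretic picture underlies the argument, although only functions
    are used below.  Let [T : C(K) -> c] be an isomorphism with inverse [S],
    where [c = C[0, omega]], and put [A = ||T||], [B = ||S||].  For [x] in [K],
    the functional [nu_x : f |-> (S f) x] on [c] has norm at most [B], and the
    sum of [|nu_x (e_n)|] over the finite coordinates is part of this norm.
    Let [mu] be the functional [g |-> (T g) omega] on [C(K)] and [w] its norm;
    then [1 / B <= w <= A], because [S] maps the constant [1] to a function on
    which [mu] is [1].

    Suppose that [x] is a limit point of a set [D].  For [y] in [D] close to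
    [x], the functionals [nu_x] and [nu_y] are almost equal on any given finite
    set of coordinates and on the constant [1].  They differ by [2] on [T g],
    where [g] has norm [1], [g x = -1] and [g y = 1], so the difference comes
    from [(T g) n - (T g) omega] for large [n].  If this oscillation is at most
    [k], then [nu_y] has mass about [2 / k] on far coordinates, where [nu_x] has
    almost none: the step from [x] to [y] gains [2 / k] of mass ([mass_step]).
    - In general, [k = A + w].
    - If [g] vanishes outside an open set [V], and some [h] of norm at most [1]
      that nearly attains the norm of [mu] vanishes on [V], then [h + g] and
      [h - g] have norm at most [1]; since [(T h) n] is close to [w] for large
      [n], little room is left for [T g], and [k = A - w] up to a small error
      ([oscillation_le]).

    From a point of the [m]-th derivative one can descend [m] times, each time
    to a limit point one rank lower.  The first step gains [2 / (A + w)], and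
    its endpoint can be chosen such that such a pair [V], [h] exists around it
    ([mass_step_avoiding]).  The other [m - 1] steps stay inside [V] and gain
    [2 / (A - w)] each.  Hence
      [2 / (A + w) + (m - 1) * (2 / (A - w)) <= B].
    For [m >= 2] this is weakest at [w = 1 / B], where with [d = A * B] it
    reads [d ^ 2 - 2 * m * d - 2 * m + 3 >= 0], and
    [m + sqrt ((m - 1) * (m + 3))] is the positive root of this quadratic
    ([steps_lower_bound]). *)

(** * Norms and bump functions on compact Hausdorff spaces *)

Lemma Cspace_norm_le (R : realType) (K : topologicalType)
    (cK : compact [set: K]) (f : Cspace R cK) (b : R) :
  0 <= b -> (forall x, `|f x| <= b) -> `|f| <= b.
Proof. exact: sup_norm_le. Qed.

Lemma Cspace_le_norm (R : realType) (K : topologicalType)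
    (cK : compact [set: K]) (f : Cspace R cK) (x : K) : `|f x| <= `|f|.
Proof. exact: le_sup_norm. Qed.

Section CompactHausdorff.
Context {R : realType} {K : topologicalType} {cK : compact [set: K]}.
Hypothesis hK : hausdorff_space K.
Local Notation CK := (Cspace R cK).

Lemma bump (V : set K) (x : K) : open V -> V x ->
  exists phi : CK, [/\ forall z, 0 <= phi z <= 1,
    forall z, ~ V z -> phi z = 0 & \forall z \near x, phi z = 1].
Proof.
move=> oV Vx.
have nK : normal_space K by exact: compact_normal.
have cx : closed [set x].
  by apply: accessible_closed_set1; exact: hausdorff_accessible.
have [W xW WV] : exists2 W, nbhs x W & closure W `<=` V.
  have [|W xW WV] := nK [set x] cx V.
    by apply/set_nbhsP; exists V; split=> // _ ->.
  exists W => //.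
  by move/set_nbhsP : xW => [U [oU xU UW]]; apply: filterS UW _;
    apply: open_nbhs_nbhs; split=> //; exact: xU.
have sep : uniform_separator (~` V) (closure W).
  move/(@normal_separatorP R) : nK; apply.
  - exact: open_closedC.
  - exact: closed_closure.
  - by apply/disjoints_subset => z nVz /WV.
pose u : K -> R := Urysohn (~` V) (closure W).
have cu : continuous u by exact: Urysohn_continuous.
exists (Cspace_of cu); split=> [z|z nVz|].
- have : range u (u z) by exists z.
  by move=> /Urysohn_range/=; rewrite in_itv.
- by apply: (Urysohn_sub0 sep); exists z.
- apply: filterS xW => z Wz; apply: (Urysohn_sub1 sep); exists z => //.
  exact: subset_closure.
Qed.

Lemma hausdorff_separate (x y : K) : x <> y ->
  exists U V, [/\ open U, open V, U x, V y & forall z, U z -> ~ V z].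
Proof.
move=> /eqP xy; move: hK; rewrite open_hausdorff => /(_ x y xy).
move=> [[U V]/= [/set_mem Ux /set_mem Vy] [oU oV /eqP UV0]].
exists U, V; split=> // z Uz Vz.
by have : (U `&` V) z by []; rewrite UV0.
Qed.

(** A difference of two bumps with disjoint supports, so that its norm is that
    of a single bump. *)
Lemma separating_function (V : set K) (x y : K) :
  open V -> V x -> V y -> x <> y ->
  exists g : CK, [/\ `|g| <= 1, forall z, ~ V z -> g z = 0, g x = -1 & g y = 1].
Proof.
move=> oV Vx Vy /hausdorff_separate[X [Y [oX oY Xx Yy XY]]].
have [f [f01 f0 /nbhs_singleton f1]] :=
  bump (openI oV oX) (conj Vx Xx : (V `&` X) x).
have [g [g01 g0 /nbhs_singleton g1]] :=
  bump (openI oV oY) (conj Vy Yy : (V `&` Y) y).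
exists (g - f); split.
- apply: Cspace_norm_le => // z; rewrite CspaceDE CspaceNE ler_norml.
  by move: (f01 z) (g01 z) => /andP[? ?] /andP[? ?]; apply/andP; split; lra.
- by move=> z nVz; rewrite CspaceDE CspaceNE f0 ?g0 ?subr0// => -[].
- by rewrite CspaceDE CspaceNE f1 g0 ?sub0r// => -[_ /(XY _ Xx)].
- by rewrite CspaceDE CspaceNE g1 f0 ?subr0// => -[_ /XY].
Qed.

End CompactHausdorff.

(** * The space of functions on the interval [0, omega] *)

Section ConvergentSequences.
Context {R : realType}.
Local Notation c := (Cspace R compact_interval_0_omega).
Local Notation om := (None : interval_0_omega).
Local Notation pt n := (Some n : interval_0_omega).

Lemma nbhs_omega (U : set interval_0_omega) : nbhs om U ->
  exists N, forall n, (N <= n)%N -> U (pt n).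
Proof.
rewrite itv_nbhsE => -[[l r] [oi /= li iU]].
suff [N HN] : exists N, forall n, (N <= n)%N ->
    (Some n : omega_plus_one) \in Interval l r.
  by exists N => n /HN /iU.
move: oi li {iU}; case: l => [[] x|[]]; case: r => [[] y|[]] //=.
- by move=> _ /andP[_]; rewrite bnd_simp ltNge; case: y.
- move=> _ /andP[+ _]; rewrite bnd_simp ltNge; case: x => // k _.
  by exists k.+1 => n kn; apply/andP; split=> //;
    rewrite bnd_simp ltNge /Order.le/= -ltnNge.
- by move=> _ /andP[_]; rewrite bnd_simp ltNge; case: y.
- by exists 0%N.
Qed.

Lemma c_eventually_close (f : c) (e : R) : 0 < e ->
  exists N, forall n, (N <= n)%N -> `|f (pt n) - f om| <= e.
Proof.
move=> e0; have /cvgrPdist_le/(_ _ e0)/nbhs_omega[N HN] :=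
  @Cspace_continuous R _ compact_interval_0_omega f om.
by exists N => n /HN; rewrite distrC.
Qed.

Lemma continuous_clopen_indic (X : topologicalType) (D : set X) :
  open D -> closed D -> continuous (\1_D : X -> R).
Proof.
move=> oD cD x; apply: cvg_near_cst.
have [Dx|nDx] := pselect (D x).
  have : nbhs x D by exact: open_nbhs_nbhs.
  by apply: filterS => z Dz; rewrite !indicE !mem_set.
have : nbhs x (~` D).
  by apply: open_nbhs_nbhs; split => //; exact: closed_openC.
by apply: filterS => z Dz; rewrite !indicE !memNset.
Qed.

Let tail n : set interval_0_omega :=
  [set x | if x is Some k then (n <= k)%N else true].

Lemma open_tail n : open (tail n).
Proof.
case: n => [|n].
  have -> : tail 0%N = [set: interval_0_omega] by apply/seteqP; split=> // -[].
  exact: openT.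
rewrite (_ : tail n.+1 = `]pt n, +oo[%classic); first exact: rray_open.
by apply/seteqP; split=> -[k|]/=;
  rewrite in_itv//= andbT ltNge /Order.le/= -ltnNge.
Qed.

Lemma closed_tail n : closed (tail n).
Proof.
rewrite (_ : tail n = `[pt n, +oo[%classic); first exact: rray_closed.
by apply/seteqP; split=> -[k|]/=; rewrite in_itv//= andbT.
Qed.

(** The intervals [[n, omega]] are clopen, and the singleton of [n] is a
    difference of two of them. *)
Definition c_one : c := Cspace_of (@cst_continuous _ R 1).
Definition c_unit n : c :=
  Cspace_of (continuous_clopen_indic (@open_tail n) (@closed_tail n)) -
  Cspace_of (continuous_clopen_indic (@open_tail n.+1) (@closed_tail n.+1)).

Lemma c_oneE x : c_one x = 1. Proof. by []. Qed.

Lemma c_unit_omega n : c_unit n om = 0.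
Proof.
by rewrite CspaceDE CspaceNE !Cspace_ofE !indicE !mem_set ?subrr.
Qed.

Lemma c_unit_pt n k : c_unit n (pt k) = (n == k)%:R.
Proof.
rewrite CspaceDE CspaceNE !Cspace_ofE !indicE.
have tailE j : (pt k \in tail j) = (j <= k)%N by apply/idP/idP; rewrite inE.
by rewrite !tailE; case: ltngtP => // _; rewrite ?subrr ?subr0.
Qed.

End ConvergentSequences.
Lemma Cspace_sumE (R : realType) (K : topologicalType) (cK : compact [set: K])
    (I : Type) (s : seq I) (F : I -> Cspace R cK) (x : K) :
  (\sum_(i <- s) F i : Cspace R cK) x = \sum_(i <- s) F i x.
Proof.
by elim: s => [|i s IH]; rewrite ?big_nil// !big_cons CspaceDE IH.
Qed.

Lemma continuous_close_sum (R : realType) (X : topologicalType)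
    (F : nat -> X -> R) (x : X) (N : nat) (e : R) :
  (forall n, continuous (F n)) -> 0 < e ->
  \forall y \near x, \sum_(0 <= n < N) `|F n y - F n x| <= e.
Proof.
move=> cF; elim: N e => [|N IH] e e0.
  by near=> y; rewrite big_nil ltW.
have e20 : 0 < e / 2 by rewrite divr_gt0.
have /cvgrPdist_le/(_ _ e20) FN := cF N x.
near=> y; rewrite big_nat_recr//= [e]splitr lerD//; last rewrite distrC.
- by near: y; exact: IH.
- by near: y.
Unshelve. all: by end_near. Qed.

Section Truncation.
Context {R : realType}.
Local Notation c := (Cspace R compact_interval_0_omega).
Local Notation om := (None : interval_0_omega).
Local Notation pt n := (Some n : interval_0_omega).

Definition c_trunc (a : nat -> R) (M : nat) : c :=
  \sum_(0 <= n < M) a n *: c_unit n.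

Lemma c_trunc_omega a M : c_trunc a M om = 0.
Proof.
rewrite Cspace_sumE big1// => n _.
by rewrite CspaceZE c_unit_omega mulr0.
Qed.

Lemma c_trunc_pt a M k : c_trunc a M (pt k) = if (k < M)%N then a k else 0.
Proof.
rewrite Cspace_sumE; under eq_bigr do rewrite CspaceZE c_unit_pt.
case: ifPn => [kM|]; last first.
  rewrite -leqNgt => Mk; rewrite big_nat big1// => n /andP[_ nM].
  by rewrite ltn_eqF ?mulr0// (leq_trans nM).
rewrite big_mkord (bigD1 (Ordinal kM))//= eqxx mulr1.
rewrite big1 ?addr0// => i /negP ik.
by case: eqP => [ik'|]; rewrite ?mulr0//; case: ik; apply/eqP/val_inj.
Qed.

(** The constant [1] and the unit vectors span a dense subspace, with this
    explicit approximation; a functional on [c] is therefore controlled by its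
    values on them. *)
Lemma c_approx (f : c) (e : R) (M : nat) : 0 < e ->
  (forall n, (M <= n)%N -> `|f (pt n) - f om| <= e) ->
  `|f - (f om *: c_one + c_trunc (fun n => f (pt n) - f om) M)| <= e.
Proof.
move=> e0 fM; apply: Cspace_norm_le; first exact: ltW.
case=> [k|]; rewrite CspaceDE CspaceNE CspaceDE CspaceZE c_oneE mulr1.
  rewrite c_trunc_pt; case: ltnP => [_|/fM]; last by rewrite addr0.
  by rewrite [f om + _]addrC subrK subrr normr0 ltW.
by rewrite c_trunc_omega addr0 subrr normr0 ltW.
Qed.

End Truncation.

(** * Gaining mass along limit points *)

Section Isomorphism.
Context {R : realType} {K : topologicalType} {cK : compact [set: K]}.
Hypothesis hK : hausdorff_space K.
Local Notation CK := (Cspace R cK).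
Local Notation c := (Cspace R compact_interval_0_omega).
Local Notation om := (None : interval_0_omega).
Local Notation pt n := (Some n : interval_0_omega).
(* [A] and [B] bound the norms of [T] and of its inverse [S], and [w] is the
   norm of the functional [g |-> (T g) omega].  The hypothesis [wT] can be
   stated without absolute value because [g] may be replaced by [- g]. *)
Variables (T : {linear CK -> c}) (S : {linear c -> CK}).
Hypothesis TS : cancel T S.
Variables A B w : R.
Hypothesis TA : forall g : CK, `|T g| <= A * `|g|.
Hypothesis SB : forall f : c, `|S f| <= B * `|f|.
Hypothesis Tw : forall g : CK, `|g| <= 1 -> `|(T g : c) om| <= w.
Hypothesis wT : forall e : R, 0 < e ->
  exists2 g : CK, `|g| <= 1 & w - e < (T g : c) om.
Hypotheses (w0 : 0 <= w) (wA : w <= A) (B0 : 0 <= B).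

Let A0 : 0 <= A. Proof. exact: le_trans w0 wA. Qed.

(** A partial sum of the [l^1] norm of the functional [f |-> (S f) x],
    restricted to the finite coordinates. *)
Definition mass (x : K) (M : nat) : R :=
  \sum_(0 <= n < M) `|(S (c_unit n) : CK) x|.

Lemma S_trunc a M x :
  (S (c_trunc a M) : CK) x = \sum_(0 <= n < M) a n * (S (c_unit n) : CK) x.
Proof.
rewrite /c_trunc linear_sum Cspace_sumE.
by apply: eq_bigr => n _; rewrite linearZ.
Qed.

(** Evaluate [S] at the finitely supported vector of signs of the values
    [(S e_n) x]. *)
Lemma mass_le x M : mass x M <= B.
Proof.
pose a n := Num.sg ((S (c_unit n) : CK) x).
have -> : mass x M = (S (c_trunc a M) : CK) x.
  by rewrite S_trunc; apply: eq_bigr => n _; rewrite normrEsg.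
rewrite (le_trans (ler_norm _))// (le_trans (Cspace_le_norm _ _))//.
rewrite (le_trans (SB _))// ler_piMr//.
apply: Cspace_norm_le => // -[k|]; last by rewrite c_trunc_omega normr0.
rewrite c_trunc_pt; case: ifP; rewrite ?normr0// => _.
by rewrite /a normr_sg; case: (_ != _).
Qed.

Lemma mass_cat x N M : (N <= M)%N ->
  mass x M = mass x N + \sum_(N <= n < M) `|(S (c_unit n) : CK) x|.
Proof. by move=> NM; rewrite /mass (big_cat_nat (leq0n N) NM). Qed.

Lemma mass_mono x N M : (N <= M)%N -> mass x N <= mass x M.
Proof. by move=> NM; rewrite (mass_cat x NM) lerDl sumr_ge0. Qed.

Lemma mass_small_tail x N0 (e : R) : 0 < e -> exists2 N, (N0 <= N)%N &
  forall M, (N <= M)%N -> \sum_(N <= n < M) `|(S (c_unit n) : CK) x| <= e.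
Proof.
move=> e0; have hs : has_sup (range (mass x)).
  split; first by exists (mass x 0), 0%N.
  by exists B => _ [M _ <-]; exact: mass_le.
have [_ [N _ <-] supN] := sup_adherent e0 hs.
exists (maxn N0 N); first exact: leq_maxl.
move=> M NM; have M_le : mass x M <= sup (range (mass x)).
  by apply: sup_upper_bound => //; exists M.
have N_le := mass_mono x (leq_maxr N0 N).
have := mass_cat x NM; lra.
Qed.

(** The gain of one step, as an arbitrary [t < 2 / k].  The hypothesis on [k]
    concerns only functions supported in [V], since the function that separates
    [x] from [y] can be chosen so; the strict inequalities on [r] and [t]
    provide the slack that absorbs all approximation errors. *)
Lemma mass_step (V D : set K) (x : K) (k t r : R) (N0 N1 : nat) :
  open V -> V x -> limit_point D x -> 0 <= k ->
  (forall g : CK, `|g| <= 1 -> (forall z, ~ V z -> g z = 0) ->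
    forall n, (N1 <= n)%N -> `|(T g : c) (pt n) - (T g : c) om| <= k) ->
  t * k < 2 -> r < mass x N0 ->
  exists y, [/\ V y, D y, y <> x & exists M, r + t < mass y M].
Proof.
move=> oV Vx Dx k0 kV tk rN0.
pose C := 2 * B + 3 * A + k.
have C0 : 0 <= C by rewrite /C; move: A0 B0; lra.
(* [C * e] is the total error in the estimate of [g y - g x = 2] below. *)
have [e [e0 er Ce]] : exists e : R,
    [/\ 0 < e, e < mass x N0 - r & C * e < 2 - t * k].
  pose e := Num.min ((mass x N0 - r) / 2) ((2 - t * k) / (C + 1)).
  have e0 : 0 < e by rewrite lt_min !divr_gt0//; lra.
  exists e; split => //.
    by rewrite (@le_lt_trans _ _ ((mass x N0 - r) / 2)) ?ge_min ?lexx//; lra.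
  have : e <= (2 - t * k) / (C + 1) by rewrite ge_min lexx orbT.
  by rewrite ler_pdivlMr; lra.
have [N NN tailN] := mass_small_tail x (maxn N0 N1) e0.
have NN0 : (N0 <= N)%N by rewrite (leq_trans _ NN)// leq_maxl.
have NN1 : (N1 <= N)%N by rewrite (leq_trans _ NN)// leq_maxr.
have cS n : continuous (S (c_unit n) : CK) by exact: Cspace_continuous.
have c1 : \forall y \near x, `|(S c_one : CK) x - (S c_one : CK) y| <= e.
  by have /cvgrPdist_le/(_ _ e0) := @Cspace_continuous R K cK (S c_one) x.
have nV : nbhs x V by exact: open_nbhs_nbhs.
have [y [/eqP yx Dy [[yN y1] Vy]]] :=
  Dx _ (filterI (filterI (continuous_close_sum x N cS e0) c1) nV).
exists y; split => //.
have xy : x <> y by move=> xy; exact: yx.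
have [g [g1 gV gx gy]] := @separating_function R K cK hK V x y oV Vx Vy xy.
pose f : c := T g.
have fA z : `|f z| <= A.
  by rewrite (le_trans (Cspace_le_norm _ _))// (le_trans (TA _))// ler_piMr.
have [M1 fM1] := c_eventually_close f e0.
pose M := maxn M1 N; exists M.
have NM : (N <= M)%N by exact: leq_maxr.
pose a n := f (pt n) - f om.
have ak n : (N <= n)%N -> `|a n| <= k.
  by move=> Nn; apply: kV => //; exact: leq_trans Nn.
have aA n : `|a n| <= 2 * A.
  rewrite (le_trans (ler_normB _ _))//.
  by have := (fA (pt n), fA om) => -[]; lra.
pose h : CK := S (f om *: c_one + c_trunc a M).
have gh z : `|g z - h z| <= B * e.
  rewrite -[g]TS -CspaceNE -CspaceDE -linearB (le_trans (Cspace_le_norm _ _))//.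
  rewrite (le_trans (SB _))// ler_wpM2l// c_approx// => n Mn.
  by apply: fM1; rewrite (leq_trans _ Mn)// leq_maxl.
pose d n := (S (c_unit n) : CK) y - (S (c_unit n) : CK) x.
(* The increment of [h], which is close to [g], is split at the coordinate
   [N]: the constant term and the coordinates below [N] contribute [O(e)] as
   [y] is near [x]; beyond [N], only the mass at [y] matters, as the mass at
   [x] is at most [e] there. *)
have hE : h y - h x = f om * ((S c_one : CK) y - (S c_one : CK) x) +
    \sum_(0 <= n < M) a n * d n.
  rewrite /h linearD linearZ !CspaceDE !CspaceZE !S_trunc.
  rewrite (_ : \sum_(0 <= n < M) a n * d n =
    \sum_(0 <= n < M) a n * (S (c_unit n) : CK) y -
    \sum_(0 <= n < M) a n * (S (c_unit n) : CK) x); first by lra.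
  by rewrite -sumrB; apply: eq_bigr => n _; rewrite mulrBr.
have term1 : f om * ((S c_one : CK) y - (S c_one : CK) x) <= A * e.
  by rewrite (le_trans (ler_norm _))// normrM ler_pM// distrC.
pose Q := \sum_(N <= n < M) `|(S (c_unit n) : CK) y|.
have low : \sum_(0 <= n < N) a n * d n <= 2 * A * e.
  rewrite (@le_trans _ _ (2 * A * \sum_(0 <= n < N) `|d n|))//; last first.
    by rewrite ler_wpM2l// mulr_ge0.
  rewrite mulr_sumr ler_sum// => n _.
  by rewrite (le_trans (ler_norm _))// normrM ler_wpM2r.
have high : \sum_(N <= n < M) a n * d n <= k * (Q + e).
  rewrite (@le_trans _ _ (k * \sum_(N <= n < M) `|d n|))//.
    rewrite mulr_sumr ler_sum_nat// => n /andP[Nn _].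
    by rewrite (le_trans (ler_norm _))// normrM ler_wpM2r// ak.
  rewrite ler_wpM2l//.
  rewrite (@le_trans _ _ (Q + \sum_(N <= n < M) `|(S (c_unit n) : CK) x|))//.
    by rewrite -big_split/= ler_sum// => n _; exact: ler_normB.
  by rewrite lerD2l tailN.
have Qt : t <= Q.
  rewrite leNgt; apply/negP => Qt.
  have kQ : k * Q <= t * k by rewrite mulrC ler_wpM2r// ltW.
  move: hE; rewrite (big_cat_nat (leq0n N) NM)//= => hE.
  move: (gh y) (gh x); rewrite !ler_norml gx gy => /andP[_ ?] /andP[? _].
  by move: Ce; rewrite /C; nra.
have yxN : mass x N - e <= mass y N.
  rewrite lerBlDr (le_trans _ (lerD (lexx _) yN))//.
  rewrite -big_split/= ler_sum// => n _.
  by rewrite -lerBlDl (le_trans (lerB_dist _ _))// distrC.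
have := mass_mono x NN0; rewrite (mass_cat y NM) -/Q; lra.
Qed.

(** Both [h + g] and [h - g] have norm at most [1].  At [omega], where [h]
    almost attains [w], this forces [(T g) omega] to be small; at a far
    coordinate [n], where [(T h) n] is still almost [w] and [T] is bounded by
    [A], it forces [(T g) n] to be at most about [A - w]. *)
Lemma oscillation_le (V : set K) (h : CK) (e : R) : 0 < e ->
  `|h| <= 1 -> w - e < (T h : c) om -> (forall z, V z -> h z = 0) ->
  exists N, forall g : CK, `|g| <= 1 -> (forall z, ~ V z -> g z = 0) ->
    forall n, (N <= n)%N -> `|(T g : c) (pt n) - (T g : c) om| <= A - w + 3 * e.
Proof.
move=> e0 h1 hw hV; have [N hN] := c_eventually_close (T h) e0.
exists N => g g1 gV n Nn.
have hg (s : R) : `|s| <= 1 -> `|h + s *: g| <= 1.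
  move=> s1; apply: Cspace_norm_le => // z; rewrite CspaceDE CspaceZE.
  have [Vz|nVz] := pselect (V z).
    rewrite hV// add0r normrM mulr_ile1//.
    exact: le_trans (Cspace_le_norm _ _) g1.
  by rewrite gV// mulr0 addr0 (le_trans (Cspace_le_norm _ _)).
have TE (s : R) z : (T (h + s *: g) : c) z = (T h : c) z + s * (T g : c) z.
  by rewrite linearD linearZ.
have bom (s : R) : `|s| <= 1 -> (T h : c) om + s * (T g : c) om <= w.
  by move=> s1; rewrite -TE (le_trans (ler_norm _))// Tw// hg.
have bpt (s : R) : `|s| <= 1 -> (T h : c) (pt n) + s * (T g : c) (pt n) <= A.
  move=> s1; rewrite -TE (le_trans (ler_norm _))//.
  rewrite (le_trans (Cspace_le_norm _ _))// (le_trans (TA _))//.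
  by rewrite ler_piMr// hg.
have p1 : `|1 : R| <= 1 by rewrite normr1.
have m1 : `|- 1 : R| <= 1 by rewrite normrN1.
move: (bom _ p1) (bom _ m1) (bpt _ p1) (bpt _ m1) (hN n Nn).
rewrite !ler_norml => ? ? ? ? /andP[? ?]; apply/andP; split; lra.
Qed.

Lemma Cspace_mul_continuous (f g : CK) : continuous (fun z => f z * g z).
Proof. by move=> z; apply: cvgM; exact: Cspace_continuous. Qed.

(** The functional [mu : g |-> (T g) omega] cannot charge every punctured
    neighbourhood of [x] by a fixed amount.  Take a nearly extremal [g] for
    [mu] and a step from [x] to [y], with a cutoff [psi] equal to [1] near [y].
    If [mu (psi * g)] is small, then [h = g - psi * g] is still nearly extremal
    and vanishes near [y].  Otherwise, start again inside the set where all
    previous cutoffs vanish.  The cutoffs have disjoint supports, so their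
    sum [phi] satisfies [0 <= phi <= 1], and [mu (phi * g) <= w] bounds the
    number of failures. *)
Lemma mass_step_avoiding (D : set K) (x : K) (t r e : R) (N0 : nat) :
  limit_point D x -> t * (A + w) < 2 -> r < mass x N0 -> 0 < e ->
  exists y V (h : CK) M, [/\ D y, open V, V y & r + t < mass y M] /\
    [/\ `|h| <= 1, w - e < (T h : c) om & forall z, V z -> h z = 0].
Proof.
move=> Dx tAw rx e0; set goal := (exists y : K, _).
have e20 : 0 < e / 2 by rewrite divr_gt0.
have [g g1 gw] := wT e20.
pose cut (phi : CK) : CK := Cspace_of (@Cspace_mul_continuous phi g).
have cut_le (phi : CK) : (forall z, 0 <= phi z <= 1) -> `|cut phi| <= 1.
  move=> phi01; apply: Cspace_norm_le => // z.
  have /andP[p0 p1] := phi01 z.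
  rewrite Cspace_ofE normrM mulr_ile1//; first by rewrite ger0_norm.
  exact: le_trans (Cspace_le_norm _ _) g1.
suff pile j : goal \/ exists phi : CK, [/\ forall z, 0 <= phi z <= 1,
    \forall z \near x, phi z = 0 & j%:R * (e / 2) <= (T (cut phi) : c) om].
  have [j wj] : exists j : nat, w < j%:R * (e / 2).
    exists (Num.bound (w / (e / 2))); rewrite -ltr_pdivrMr//.
    by rewrite archi_boundP// divr_ge0// ltW.
  have [//|[phi [phi01 _]]] := pile j.
  rewrite leNgt => /negP[]; rewrite (le_lt_trans _ wj)//.
  by rewrite (le_trans (ler_norm _))// Tw// cut_le.
elim: j => [|j [?|[phi [phi01 phix phiw]]]]; [right|by left|].
  exists 0; split => [z||]; rewrite ?Cspace0E ?lexx ?ler01//.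
    by apply: nearW => z; rewrite Cspace0E.
  rewrite (_ : cut 0 = 0) ?linear0 ?Cspace0E ?mul0r//.
  by apply: CspaceP => z; rewrite Cspace_ofE !Cspace0E mul0r.
pose O := [set z | phi z = 0]°.
have oO : open O by exact: open_interior.
have [||||y [Oy Dy yx [M rM]]] :=
  @mass_step O D x (A + w) t r N0 0%N oO phix Dx.
- by rewrite addr_ge0.
- move=> f f1 _ n _; rewrite (le_trans (ler_normB _ _))// lerD// ?Tw//.
  by rewrite (le_trans (Cspace_le_norm _ _))// (le_trans (TA _))// ler_piMr.
- by [].
- by [].
have [Y [X [oY oX Yy Xx YX]]] := hausdorff_separate hK yx.
have [psi [psi01 psi0 psi1]] :=
  @bump R K cK hK (O `&` Y) y (openI oO oY) (conj Oy Yy).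
have [psiw|psiw] := lerP ((T (cut psi) : c) om) (e / 2).
  left; exists y, [set z | psi z = 1]°, (g - cut psi), M; split; split => //.
  - exact: open_interior.
  - apply: Cspace_norm_le => // z.
    rewrite CspaceDE CspaceNE Cspace_ofE -[X in `|X - _|]mul1r -mulrBl normrM.
    have /andP[p0 p1] := psi01 z.
    rewrite mulr_ile1//; last exact: le_trans (Cspace_le_norm _ _) g1.
    by rewrite ger0_norm; lra.
  - by rewrite linearB CspaceDE CspaceNE; lra.
  - move=> z /interior_subset psiz.
    rewrite /= in psiz.
    by rewrite CspaceDE CspaceNE Cspace_ofE psiz mul1r subrr.
right; exists (phi + psi); split => [z||].
- rewrite CspaceDE; have [Oz|nOz] := pselect (O z).
    by move: Oz => /interior_subset/= ->; rewrite add0r.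
  by rewrite psi0 ?addr0// => -[].
- have nX : nbhs x X by exact: open_nbhs_nbhs.
  apply: filterS2 phix nX => z phiz Xz.
  by rewrite CspaceDE phiz psi0 ?addr0// => -[_ /YX].
- have -> : cut (phi + psi) = cut phi + cut psi.
    apply: CspaceP => z.
    by rewrite CspaceDE !Cspace_ofE -mulrDl.
  by rewrite linearD CspaceDE -natr1 mulrDl mul1r lerD// ltW.
Qed.

Lemma cb_derivative_limit_point n x : cb_derivative K n.+1 x ->
  cb_derivative K n x /\ limit_point (cb_derivative K n) x.
Proof.
move=> [xn xniso]; split => // U xU; apply: contrapT => noy.
apply: xniso; split; first exact: mem_set.
exists U => //; apply/seteqP; split => [y [Uy ny]|_ ->]; last first.
  by split => //; exact: nbhs_singleton.
by apply: contrapT => /eqP yx; apply: noy; exists y.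
Qed.

Lemma mass_iterate (V : set K) (k t : R) (N1 : nat) : open V -> 0 <= k ->
  (forall g : CK, `|g| <= 1 -> (forall z, ~ V z -> g z = 0) ->
    forall n, (N1 <= n)%N -> `|(T g : c) (pt n) - (T g : c) om| <= k) ->
  t * k < 2 ->
  forall n y r M, cb_derivative K n y -> V y -> r < mass y M ->
  exists z M', r + n%:R * t < mass z M'.
Proof.
move=> oV k0 kV tk; elim=> [|n IH] y r M ny Vy rM.
  by exists y, M; rewrite mul0r addr0.
have [_ accy] := cb_derivative_limit_point ny.
have [z [Vz nz _ [M' rM']]] := mass_step oV Vy accy k0 kV tk rM.
have [u [M'' uM]] := IH z _ M' nz Vz rM'.
by exists u, M''; rewrite -natr1 mulrDl mul1r [_ * t + t]addrC addrA.
Qed.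

(** The first step is taken with the oscillation bound [A + w]; the other [n]
    stay in the set [V] that it provides, where the bound is [A - w] up to an
    error. *)
Lemma steps_le_norm n (t1 t2 : R) : cb_derivative K n.+1 !=set0 ->
  0 <= t2 -> t1 * (A + w) < 2 -> t2 * (A - w) < 2 -> t1 + n%:R * t2 <= B.
Proof.
move=> [x nx] t20 t1Aw t2Aw; apply/ler_addgt0Pr => d d0.
have [_ accx] := cb_derivative_limit_point nx.
(* Small enough for [t2 * (3 * e)] to fit into the gap of [t2 * (A - w) < 2]. *)
pose e := (2 - t2 * (A - w)) / (6 * (t2 + 1)).
have e0 : 0 < e by rewrite divr_gt0//; lra.
have et2 : t2 * (A - w + 3 * e) < 2.
  have : e * (6 * (t2 + 1)) = 2 - t2 * (A - w).
    by rewrite divfK// gt_eqF//; lra.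
  by nra.
have mx : - d < mass x 0 by rewrite /mass big_nil oppr_lt0.
have [y [V [h [M [[ny oV Vy yM] [h1 hw hV]]]]]] :=
  mass_step_avoiding accx t1Aw mx e0.
have [N kV] := oscillation_le e0 h1 hw hV.
have k0 : 0 <= A - w + 3 * e by move: wA; lra.
have [z [M' zM]] := mass_iterate oV k0 kV et2 ny Vy yM.
have := mass_le z M'; lra.
Qed.

End Isomorphism.

(** * From the gains to the distance *)

(** With [d = A * B] and [u = w * B >= 1], the gains give
    [2 * (d - u) + 2 * n * (d + u) <= d ^ 2 - u ^ 2], which for [n >= 1] is
    weakest at [u = 1].  The case [w = A] is excluded because then [t2] would
    be unbounded. *)
Lemma steps_lower_bound (R : realType) (n : nat) (A B w : R) :
  (0 < n)%N -> w <= A -> 1 <= w * B -> 0 < B ->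
  (forall t1 t2 : R, 0 <= t2 -> t1 * (A + w) < 2 -> t2 * (A - w) < 2 ->
    t1 + n%:R * t2 <= B) ->
  n.+1%:R + Num.sqrt ((n.+1%:R - 1) * (n.+1%:R + 3)) <= A * B.
Proof.
move=> n0 wA wB B0 tB; have n1 : 1 <= n%:R :> R by rewrite ler1n.
have w0 : 0 < w by rewrite -(pmulr_lgt0 _ B0); lra.
have wltA : w < A.
  rewrite lt_neqAle wA andbT; apply/eqP => wEA.
  have := tB 0 (B + 1); rewrite -wEA subrr !mulr0 mul0r add0r.
  have B10 : 0 <= B + 1 by lra.
  by move=> /(_ B10 (ltr0n _ _) (ltr0n _ _)); nra.
have p0 : 0 < A + w by lra.
have m0 : 0 < A - w by lra.
have key : 2 / (A + w) + n%:R * (2 / (A - w)) <= B.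
  rewrite leNgt; apply/negP => BZ.
  set Z := (X in B < X) in BZ.
  have Z0 : 0 < Z by lra.
  have [s [s0 s1 BsZ]] : exists s, [/\ 0 < s, s < 1 & B < s * Z].
    have BZ1 : B / Z < 1 by rewrite ltr_pdivrMr// mul1r.
    have BZ0 : 0 < B / Z by rewrite divr_gt0.
    exists ((B / Z + 1) / 2); split; [lra|lra|].
    by rewrite -ltr_pdivrMr//; lra.
  have lt2 a : 0 < a -> s * (2 / a) * a < 2.
    by move=> a0; rewrite -mulrA divfK ?gt_eqF//; lra.
  have q0 : 0 <= s * (2 / (A - w)).
    by apply: mulr_ge0; [exact: ltW|apply: divr_ge0 => //; exact: ltW].
  have := tB _ _ q0 (lt2 _ p0) (lt2 _ m0).
  by rewrite [n%:R * _]mulrCA -mulrDr -/Z leNgt BsZ.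
have {}key : 2 * (A - w) + n%:R * 2 * (A + w) <= B * ((A + w) * (A - w)).
  have -> : 2 * (A - w) + n%:R * 2 * (A + w) =
      (2 / (A + w) + n%:R * (2 / (A - w))) * ((A + w) * (A - w)).
    by field; rewrite !gt_eqF.
  by rewrite ler_wpM2r// ltW// mulr_gt0.
pose d := A * B; pose u := w * B.
have {}key : 2 * (d - u) + n%:R * 2 * (d + u) <= (d + u) * (d - u).
  have := ler_wpM2r (ltW B0) key.
  by rewrite /d /u; lra.
have d0 : 0 < d by rewrite mulr_gt0//; lra.
have u1 : 1 <= u by [].
rewrite -/d; move: d u d0 u1 key => d u d0 u1 key.
have quad : 0 <= d ^+ 2 - 2 * (n%:R + 1) * d - 2 * (n%:R + 1) + 3.
  have uu : 1 <= u ^+ 2 by rewrite exprn_ege1.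
  have nu : 0 <= (n%:R - 1) * (u - 1) by rewrite mulr_ge0 ?subr_ge0.
  by nra.
rewrite -natr1; set q := Num.sqrt _.
have q2 : q ^+ 2 = (n%:R + 1 - 1) * (n%:R + 1 + 3).
  by rewrite sqr_sqrtr// mulr_ge0//; lra.
have q0 : 0 <= q by exact: sqrtr_ge0.
(* The other root [n + 1 - q] of the quadratic is at most [0]. *)
have nq : n%:R + 1 <= q by rewrite leNgt; apply/negP => qn; nra.
rewrite leNgt; apply/negP => dq.
have : 0 < (q - (d - (n%:R + 1))) * (q + (d - (n%:R + 1))).
  by rewrite mulr_gt0//; lra.
by nra.
Qed.

Lemma op_norm_ub (R : realType) (X Y : normedModType R) (T : X -> Y) x :
  bounded_fun_norm T -> `|x| <= 1 -> `|T x| <= op_norm T.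
Proof.
move=> bT x1; apply: ub_le_sup; last by exists x.
by have [M HM] := bT 1; exists M => _ [y /= y1 <-]; exact: HM.
Qed.

Lemma op_norm_le (R : realType) (X Y : normedModType R) (T : {linear X -> Y})
    (x : X) : bounded_fun_norm T -> `|T x| <= op_norm T * `|x|.
Proof.
move=> bT; have [->|x0] := eqVneq x 0; first by rewrite linear0 !normr0 mulr0.
have x_gt0 : 0 < `|x| by rewrite normr_gt0.
rewrite -ler_pdivrMr//.
have -> : `|T x| / `|x| = `|T (`|x|^-1 *: x)|.
  by rewrite linearZ normrZ normfV normr_id mulrC.
by apply: op_norm_ub => //; rewrite normrZ normfV normr_id mulVf ?gt_eqF.
Qed.

Theorem theorem4p2 (R : realType) (m : nat) (K : topologicalType)
    (cK : compact [set: K]) :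
  (2 <= m)%N -> hausdorff_space K -> cb_derivative K m !=set0 ->
  ((m%:R + Num.sqrt ((m%:R - 1) * (m%:R + 3)))%:E
     <= dBM (Cspace R cK) (Cspace R compact_interval_0_omega))%E.
Proof.
case: m => // n n1 hK Kn; apply/ereal_infP => _ [T [S [bT bS TS ST ->]]].
rewrite lee_fin.
pose c := Cspace R compact_interval_0_omega.
pose om : interval_0_omega := None.
pose lim_fun (g : Cspace R cK) : R := (T g : c) om.
pose E := [set `|lim_fun g| | g in [set g | `|g| <= 1]].
have T_le (g : Cspace R cK) : `|g| <= 1 -> `|lim_fun g| <= op_norm T.
  by move=> g1; rewrite (le_trans (Cspace_le_norm _ _))// op_norm_ub.
have hE : has_sup E.
  split; first by exists `|lim_fun 0|, 0 => //=; rewrite normr0.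
  by exists (op_norm T) => _ [g g1 <-]; exact: T_le.
pose w := sup E.
have Tw (g : Cspace R cK) : `|g| <= 1 -> `|lim_fun g| <= w.
  by move=> g1; apply: sup_upper_bound => //; exists g.
have wA : w <= op_norm T.
  by apply: ge_sup; [exact: hE.1|move=> _ [g g1 <-]; exact: T_le].
have wT (e : R) : 0 < e ->
    exists2 g : Cspace R cK, `|g| <= 1 & w - e < lim_fun g.
  move=> /sup_adherent/(_ hE)[_ [g g1 <-] gw].
  have [Tg|Tg] := lerP 0 (lim_fun g).
    by exists g => //; move: gw; rewrite ger0_norm.
  exists (- g); first by rewrite normrN.
  have -> : lim_fun (- g) = - lim_fun g by rewrite /lim_fun linearN.
  by rewrite -(ltr0_norm Tg).
have w0 : 0 <= w by rewrite (le_trans _ (Tw 0 _)) ?normr0.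
have S1 : 0 < `|S c_one|.
  rewrite normr_gt0; apply/eqP => S10.
  have c10 : c_one = 0 :> c by rewrite -(ST c_one) S10 linear0.
  have /eqP : 1 = 0 :> R := congr1 (fun f : c => f om) c10.
  by rewrite oner_eq0.
have S1_le : `|S c_one| <= op_norm S.
  apply: op_norm_ub => //; apply: Cspace_norm_le => // z.
  by rewrite c_oneE normr1.
have wB : 1 <= w * op_norm S.
  rewrite (le_trans _ (ler_wpM2l w0 S1_le))// -ler_pdivrMr// mul1r.
  have := @Tw (`|S c_one|^-1 *: S c_one).
  rewrite normrZ normfV normr_id mulVf ?gt_eqF// => /(_ (lexx _)).
  have -> : lim_fun (`|S c_one|^-1 *: S c_one) = `|S c_one|^-1.
    by rewrite /lim_fun linearZ ST; exact: mulr1.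
  by rewrite ger0_norm// invr_ge0 ltW.
have B0 : 0 < op_norm S by exact: lt_le_trans S1_le.
apply: (steps_lower_bound n1 wA wB B0) => t1 t2.
apply: (steps_le_norm hK TS _ _ Tw wT w0 wA (ltW B0) Kn) => f;
  exact: op_norm_le.
Qed.
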